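(* Consider the single stage pricing game with multiplicative loyalty described in the context, with parameters $c_A\ge c_B\ge 0$, $l_\alpha,l_\beta>0$, $\theta\in(0,1)$, and $F$ the distribution function of the uniform distribution on $[0,1]$. Suppose (Region II) $$c_A-c_B\ge\max\{2l_\alpha,\,l_\beta\} .$$ Then the game has a unique pure Nash equilibrium, and its prices are $$p_A^\alpha=c_A,\quad p_A^\beta=c_A,\quad p_B^\beta=c_A,\quad p_B^\alpha=c_A-l_\alpha .$$
   Context: Two firms $A$ and $B$ sell the same product, with unit product costs $c_A$ and $c_B$, where $c_A\ge c_B\ge 0$. Customers are partitioned into a set $\alpha$ (ex ante loyal to $A$; a fraction $\theta$ of the market) and a set $\beta$ (ex ante loyal to $B$; a fraction $1-\theta$). Both firms can tell the two sets apart. Each customer buys exactly one unit, from $A$ or from $B$. Firms move simultaneously: $A$ chooses $(p_A^\alpha,p_A^\beta)$ with $p_A^\alpha,p_A^\beta\ge c_A$, and $B$ chooses $(p_B^\beta,p_B^\alpha)$ with $p_B^\beta,p_B^\alpha\ge c_B$; the superscript is the set of customers to which the price is offered. Multiplicative loyalty: a customer in $\alpha$ has loyalty level $l_\alpha\xi$ and buys from $A$ iff $l_\alpha\xi\ge p_A^\alpha-p_B^\alpha$; a customer in $\beta$ has loyalty level $l_\beta\xi$ and buys from $B$ iff $l_\beta\xi\ge p_B^\beta-p_A^\beta$; here $\xi$ is random with distribution function $F$. Put $\xi^\alpha=(p_A^\alpha-p_B^\alpha)/l_\alpha$ and $\xi^\beta=(p_B^\beta-p_A^\beta)/l_\beta$.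 For the uniform distribution, $F(x)=0$ for $x\le 0$, $F(x)=x$ for $0\le x\le1$, $F(x)=1$ for $x\ge1$. Profits: firm $A$ gets $(p_A^\alpha-c_A)\,\theta\,(1-F(\xi^\alpha))+(p_A^\beta-c_A)(1-\theta)F(\xi^\beta)$; firm $B$ gets $(p_B^\beta-c_B)(1-\theta)(1-F(\xi^\beta))+(p_B^\alpha-c_B)\,\theta\,F(\xi^\alpha)$. A pure Nash equilibrium is a price profile $(p_A^\alpha,p_A^\beta,p_B^\beta,p_B^\alpha)$ from which neither firm can strictly increase its profit by unilaterally changing its own (feasible) prices. *)

(* Defs.v *)
From HB Require Import structures.
From mathcomp Require Import all_boot all_order all_algebra.
From mathcomp Require Import reals.

Set Implicit Arguments.
Unset Strict Implicit.
Unset Printing Implicit Defensive.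

Import Order.TTheory GRing.Theory Num.Theory.
Local Open Scope ring_scope.

Record market (R : realType) := Market {
  cA : R;
  cB : R;
  theta : R;      (* fraction of the customers that are in alpha *)
  lalpha : R;
  lbeta : R;
  F : R -> R      (* distribution function of the random loyalty factor *)
}.

(* pX_s is the price that firm X offers to the customers of the set s. *)
Record profile (R : realType) := Profile {
  pA_alpha : R;
  pA_beta : R;
  pB_beta : R;
  pB_alpha : R
}.

(* The customers of alpha (resp. beta) whose loyalty factor is at least
   xi_alpha (resp. xi_beta) stay with A (resp. B); the others switch. *)
Definition xi_alpha (R : realType) (M : market R) (s : profile R) : R :=
  (pA_alpha s - pB_alpha s) / lalpha M.

Definition xi_beta (R : realType) (M : market R) (s : profile R) : R :=
  (pB_beta s - pA_beta s) / lbeta M.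

Definition profitA (R : realType) (M : market R) (s : profile R) : R :=
  (pA_alpha s - cA M) * theta M * (1 - F M (xi_alpha M s))
  + (pA_beta s - cA M) * (1 - theta M) * F M (xi_beta M s).

Definition profitB (R : realType) (M : market R) (s : profile R) : R :=
  (pB_beta s - cB M) * (1 - theta M) * (1 - F M (xi_beta M s))
  + (pB_alpha s - cB M) * theta M * F M (xi_alpha M s).

Definition feasibleA (R : realType) (M : market R) (p_alpha p_beta : R) : Prop :=
  cA M <= p_alpha /\ cA M <= p_beta.

Definition feasibleB (R : realType) (M : market R) (p_beta p_alpha : R) : Prop :=
  cB M <= p_beta /\ cB M <= p_alpha.

Definition pure_nash (R : realType) (M : market R) (s : profile R) : Prop :=
  [/\ feasibleA M (pA_alpha s) (pA_beta s),
      feasibleB M (pB_beta s) (pB_alpha s),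
      forall p_alpha p_beta : R, feasibleA M p_alpha p_beta ->
        profitA M (Profile p_alpha p_beta (pB_beta s) (pB_alpha s))
        <= profitA M s
    & forall p_beta p_alpha : R, feasibleB M p_beta p_alpha ->
        profitB M (Profile (pA_alpha s) (pA_beta s) p_beta p_alpha)
        <= profitB M s].

Definition uniform_cdf (R : realType) (x : R) : R :=
  if x <= 0 then 0 else if x <= 1 then x else 1.

(* Main.v *)
Require Import Defs.
From HB Require Import structures.
From mathcomp Require Import all_boot all_order all_algebra.
From mathcomp Require Import reals.
From mathcomp Require Import ring lra.

Set Implicit Arguments.
Unset Strict Implicit.
Unset Printing Implicit Defensive.

Import Order.TTheory GRing.Theory Num.Theory.
Local Open Scope ring_scope.

(** The two sets of customers are independent markets, in each of which firm [B]
    has a unique best response to every price [p >= cA] of [A]: it serves the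
    whole market at the highest price doing so, [p - lalpha] in [alpha] (where
    [cA - cB >= 2 * lalpha] makes undercutting that far worthwhile) and [p] in
    [beta] (where [cA - cB >= lbeta] makes it not worthwhile to ask for more).
    Hence [A] sells nothing in an equilibrium, and if one of its prices exceeded
    [cA] it would gain by moving that price halfway towards [cA]. *)

Lemma uniform_cdf_le0 (R : realType) (x : R) : x <= 0 -> uniform_cdf x = 0.
Proof. by rewrite /uniform_cdf => ->. Qed.

Lemma uniform_cdf_ge1 (R : realType) (x : R) : 1 <= x -> uniform_cdf x = 1.
Proof.
rewrite /uniform_cdf => x1; rewrite leNgt (lt_le_trans ltr01 x1) /=.
by case: (leP x 1) => // ?; apply/eqP; rewrite eq_le; apply/andP.
Qed.

Lemma uniform_cdf_id (R : realType) (x : R) : 0 <= x <= 1 -> uniform_cdf x = x.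
Proof.
rewrite /uniform_cdf => /andP[x0 ->]; case: (leP x 0) => // ?.
by apply/eqP; rewrite eq_le; apply/andP.
Qed.

Lemma uniform_cdf_gt0 (R : realType) (x : R) : 0 < x -> 0 < uniform_cdf x.
Proof.
by rewrite /uniform_cdf => x0; rewrite leNgt x0 /=; case: ifP.
Qed.

Lemma uniform_cdf_lt1 (R : realType) (x : R) : x < 1 -> uniform_cdf x < 1.
Proof.
by rewrite /uniform_cdf => x1; case: ifP => // _; rewrite (ltW x1).
Qed.

(** The equality clause of [?= iff] carries uniqueness: any other price earns strictly less, so an
    equilibrium price of [B] is forced. *)
Lemma entrant_best_response (R : realType) (c l p q : R) :
  0 < l -> 2 * l <= p - c ->
  (q - c) * uniform_cdf ((p - q) / l) <= p - l - c ?= iff (q == p - l).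
Proof.
move=> l0 hl; apply/leifP; case: eqP => [->|/eqP qNpl].
  by rewrite uniform_cdf_ge1 ?mulr1 // subKr divff // gt_eqF.
case: (leP (p - q) 0) => [h|h].
  rewrite uniform_cdf_le0 ?mulr0; first lra.
  by rewrite ler_pdivrMr // mul0r.
case: (leP l (p - q)) => [h'|h'].
  rewrite uniform_cdf_ge1 ?mulr1; last by rewrite ler_pdivlMr // mul1r.
  rewrite ltrD2r lt_neqAle qNpl /=; lra.
rewrite uniform_cdf_id; last by rewrite divr_ge0 ?ler_pdivrMr ?mul1r //; lra.
(* With [d = p - q] in [(0, l)], [l] times the shortfall is [(l - d) * (p - c - l - d)], positive
   because [p - c >= 2 * l > l + d]. *)
rewrite mulrA ltr_pdivrMr //; nra.
Qed.

Lemma incumbent_best_response (R : realType) (c l p q : R) :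
  0 < l -> l <= q - c ->
  (p - c) * (1 - uniform_cdf ((p - q) / l)) <= q - c ?= iff (p == q).
Proof.
move=> l0 hl; apply/leifP; case: eqP => [->|/eqP pNq].
  by rewrite subrr mul0r uniform_cdf_le0 // subr0 mulr1.
case: (leP (p - q) 0) => [h|h].
  rewrite uniform_cdf_le0 ?subr0 ?mulr1; last by rewrite ler_pdivrMr // mul0r.
  rewrite ltrD2r lt_neqAle pNq /=; lra.
case: (leP l (p - q)) => [h'|h'].
  rewrite uniform_cdf_ge1; last by rewrite ler_pdivlMr // mul1r.
  rewrite subrr mulr0; lra.
rewrite uniform_cdf_id; last by rewrite divr_ge0 ?ler_pdivrMr ?mul1r //; lra.
have -> : 1 - (p - q) / l = (l - (p - q)) / l by field; rewrite gt_eqF.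
(* With [d = p - q > 0], [l] times the shortfall is [d * (q - c - l + d)], positive because
   [q - c >= l]. *)
rewrite mulrA ltr_pdivrMr //; nra.
Qed.

Theorem proposition11 (R : realType) (c_A c_B l_alpha l_beta th : R)
    (hcB : 0 <= c_B) (hcA : c_B <= c_A)
    (hla : 0 < l_alpha) (hlb : 0 < l_beta)
    (hth0 : 0 < th) (hth1 : th < 1)
    (hII : Num.max (2 * l_alpha) l_beta <= c_A - c_B) :
  let M := Market c_A c_B th l_alpha l_beta (@uniform_cdf R) in
  let s0 := {| pA_alpha := c_A; pA_beta := c_A;
               pB_beta := c_A; pB_alpha := c_A - l_alpha |} in
  pure_nash M s0 /\ (forall s : profile R, pure_nash M s -> s = s0).
Proof.
move=> M s0; move: hII; rewrite ge_max => /andP[hDa hDb].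
have th'0 : 0 < 1 - th by rewrite subr_gt0.
have profitBE a a' b b' : profitB M (Profile a a' b b') =
    (1 - th) * ((b - c_B) * (1 - uniform_cdf ((b - a') / l_beta)))
    + th * ((b' - c_B) * uniform_cdf ((a - b') / l_alpha)).
  by rewrite /profitB /xi_beta /xi_alpha /=; ring.
split.
  split; rewrite /feasibleA /feasibleB /=; [by []|lra| |].
    move=> p p' [hp hp']; rewrite /profitA /xi_beta /xi_alpha /=.
    (* Margins of [A] vanish at [s0]. A deviation to prices at least [c_A] keeps the [alpha]
       threshold at or above 1 and the [beta] threshold at or below 0, so [A] still sells
       nothing. *)
    rewrite !subrr !mul0r addr0 uniform_cdf_ge1; last first.
      by rewrite ler_pdivlMr //; lra.
    rewrite subrr mulr0 add0r uniform_cdf_le0 ?mulr0 //.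
    by rewrite ler_pdivrMr //; lra.
  move=> p p' _; rewrite !profitBE.
  apply: lerD; rewrite ler_pM2l //.
    rewrite (eqTleif (incumbent_best_response c_A hlb hDb) (eqxx _)).
    exact: (incumbent_best_response p hlb hDb).1.
  rewrite (eqTleif (entrant_best_response (c_A - l_alpha) hla hDa) (eqxx _)).
  exact: (entrant_best_response p' hla hDa).1.
move=> [a a' b b'] [[/= ha ha'] [/= hb hb'] /= nashA nashB].
have hDa' : 2 * l_alpha <= a - c_B by lra.
have hDb' : l_beta <= a' - c_B by lra.
have ba' : b = a'.
  have best := incumbent_best_response a' hlb hDb'.
  (* Deviating in [beta] alone cancels the [alpha] terms; what remains says that [b] attains the
     maximum. *)
  have := nashB a' b' (conj (le_trans hcA ha') hb').
  rewrite !profitBE lerD2r ler_pM2l // (eqTleif best (eqxx _)).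
  by rewrite (ge_leif (incumbent_best_response b hlb hDb')) => /eqP.
have ba : b' = a - l_alpha.
  have best := entrant_best_response (a - l_alpha) hla hDa'.
  have fb : c_B <= a - l_alpha by lra.
  have := nashB b (a - l_alpha) (conj hb fb).
  rewrite !profitBE lerD2l ler_pM2l // (eqTleif best (eqxx _)).
  by rewrite (ge_leif (entrant_best_response b' hla hDa')) => /eqP.
subst b b'.
have ea : a = c_A.
  apply/eqP; rewrite eq_le ha andbT leNgt; apply/negP => agt.
  (* At [a] the threshold is exactly 1; the midpoint brings it below 1 and keeps a positive
     margin. *)
  have fa : c_A <= (a + c_A) / 2 by lra.
  have := nashA ((a + c_A) / 2) a' (conj fa ha').
  rewrite /profitA /xi_alpha /xi_beta /= lerD2r subKr divff ?gt_eqF //.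
  rewrite (uniform_cdf_ge1 (lexx 1)) subrr mulr0 leNgt => /negP; apply.
  rewrite mulr_gt0 ?mulr_gt0 ?subr_gt0 ?uniform_cdf_lt1 //; first lra.
  by rewrite ltr_pdivrMr //; lra.
have ea' : a' = c_A.
  apply/eqP; rewrite eq_le ha' andbT leNgt; apply/negP => agt.
  (* Here the threshold at [a'] is exactly 0, and the midpoint makes it positive. *)
  have fa' : c_A <= (a' + c_A) / 2 by lra.
  have := nashA a ((a' + c_A) / 2) (conj ha fa').
  rewrite /profitA /xi_alpha /xi_beta /= lerD2l subrr mul0r.
  rewrite (uniform_cdf_le0 (lexx 0)) mulr0 leNgt => /negP; apply.
  rewrite !mulr_gt0 ?uniform_cdf_gt0 ?divr_gt0 //; lra.
by rewrite /s0 ea ea'.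
Qed.
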